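(* Fix an integer $r\ge 1$. Let $\tau_1,\ldots,\tau_r$ be independent, uniformly random elements of $\mathfrak{M}_n$, and let $p_{\min}=P(\inf(\tau_1,\ldots,\tau_r)=\tau_{\min})$. Then \[ p_{\min}\sim \frac{r}{A(n)}\qquad\text{as } n\to\infty. \]
   Context: A monotone triangle of size $n$ is a triangular array of integers $\tau=(\tau(i,j))_{1\le j\le i\le n}$, with $i$ entries in row $i$, all entries taken from $[n]=\{1,\ldots,n\}$, such that $\tau(i,j)<\tau(i,j+1)$ and $\tau(i,j)\le \tau(i-1,j)\le \tau(i,j+1)$ whenever $1\le j<i$. Let $\mathfrak{M}_n$ be the set of monotone triangles of size $n$ and $A(n)=|\mathfrak{M}_n|$. For $\tau_1,\ldots,\tau_r\in\mathfrak{M}_n$, $\inf(\tau_1,\ldots,\tau_r)$ is the triangle whose $(i,j)$ entry is $\min_k\tau_k(i,j)$. $\tau_{\min}$ is the monotone triangle whose row $i$ is $1,2,\ldots,i$ for every $i\in[n]$. *)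

(* Defs.v *)
From HB Require Import structures.
From mathcomp Require Import all_boot all_order all_algebra.
From mathcomp Require Import all_classical all_reals all_analysis.

Set Implicit Arguments.
Unset Strict Implicit.
Unset Printing Implicit Defensive.

Import Order.TTheory GRing.Theory Num.Theory.
Import numFieldNormedType.Exports.

Local Open Scope classical_set_scope.
Local Open Scope ring_scope.

(* Positions of a triangular array with n rows.  The ordinals are 0-based;
   [pos_row] and [pos_col] are the 1-based coordinates, so that
   1 <= pos_col p <= pos_row p <= n. *)
Definition position (n : nat) : finType := {i : 'I_n & 'I_i.+1}.

Definition pos_row (n : nat) (p : position n) : nat := (tag p).+1.
Definition pos_col (n : nat) (p : position n) : nat := (tagged p).+1.

(* An array has entries in {0, ..., n}; [is_monotone] excludes the value 0, so
   that the entries of a monotone triangle lie in {1, ..., n}. *)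
Notation array n := {ffun position n -> 'I_n.+1}.

Definition is_monotone (n : nat) (t : array n) : bool :=
  [&& [forall p, 0 < t p]%N,
      (* t(i, j) < t(i, j + 1) *)
      [forall p, forall q,
         (pos_row q == pos_row p)
           && (pos_col q == (pos_col p).+1) ==> (t p < t q)%N],
      (* t(i, j) <= t(i - 1, j) *)
      [forall p, forall q,
         (pos_row p == (pos_row q).+1)
           && (pos_col q == pos_col p) ==> (t p <= t q)%N]
    & (* t(i - 1, j) <= t(i, j + 1) *)
      [forall p, forall q,
         (pos_row p == (pos_row q).+1)
           && (pos_col p == (pos_col q).+1) ==> (t q <= t p)%N]].

Record monotone_triangle (n : nat) := MonotoneTriangle {
  mt_array :> array n;
  mt_monotone : is_monotone mt_array }.

HB.instance Definition _ n := [isSub for @mt_array n].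
HB.instance Definition _ n := [Finite of monotone_triangle n by <:].

Definition A (n : nat) : nat := #|{: monotone_triangle n}|.

(* Entrywise minimum; the default value for r = 0 is the top element n. *)
Definition inf_array (n r : nat) (t : 'I_r -> monotone_triangle n) : array n :=
  [ffun p => \big[Order.min/ord_max]_(k < r) t k p].

(* pos_col p <= n, so [inord] does not truncate. *)
Definition tau_min_array (n : nat) : array n := [ffun p => inord (pos_col p)].

Lemma tau_min_arrayE (n : nat) (p : position n) :
  tau_min_array n p = pos_col p :> nat.
Proof.
rewrite ffunE inordK // ltnS /pos_col.
exact: leq_trans (ltn_ord (tagged p)) (ltn_ord (tag p)).
Qed.

Lemma tau_min_monotone (n : nat) : is_monotone (tau_min_array n).
Proof.
apply/and4P; split; apply/forallP => p; first by rewrite tau_min_arrayE.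
- by apply/forallP => q; apply/implyP => /andP[_ /eqP e]; rewrite !tau_min_arrayE e.
- by apply/forallP => q; apply/implyP => /andP[_ /eqP e]; rewrite !tau_min_arrayE e.
- by apply/forallP => q; apply/implyP => /andP[_ /eqP e]; rewrite !tau_min_arrayE e.
Qed.

Definition tau_min (n : nat) : monotone_triangle n :=
  MonotoneTriangle (tau_min_monotone n).

Section random_elements.
Context {d : measure_display} {T : measurableType d} {R : realType}.
Variable P : probability T R.

(* Finite sets carry the discrete sigma-algebra. *)
Definition random_element (S : finType) (X : T -> S) : Prop :=
  forall B : set S, measurable (X @^-1` B).

Definition uniform_law (S : finType) (X : T -> S) : Prop :=
  forall s : S, P (X @^-1` [set s]) = (#|S|%:R^-1)%:E.

Definition mutually_independent (I S : finType) (X : I -> T -> S) : Prop :=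
  forall (J : {set I}) (B : I -> set S),
    P (\bigcap_(k in [set` J]) X k @^-1` B k) =
    (\prod_(k in J) P (X k @^-1` B k))%E.

End random_elements.

(* Main.v *)
Require Import Defs.
From HB Require Import structures.
From mathcomp Require Import all_boot all_order all_algebra.
From mathcomp Require Import all_classical all_reals all_analysis.
From mathcomp Require Import zify lra.

(* Let n = N + 1 and B(k) = A(k + 1). If the infimum of t_1, ..., t_r is tau_min,
   then each row i <= N is minimal (equal to 1, ..., i) in some t_k. The tuples
   containing tau_min itself account for the main term r / A(n), and the others
   have to be shown negligible.

   Deleting a minimal row i together with the value i shows that at most
   B(N - |S|) triangles are minimal on a given set S of rows. Minimality of a row
   is a decreasing event in the distributive lattice of monotone triangles, so
   the Ahlswede-Daykin inequality, applied to the first and the last but one row,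
   makes B log-convex. Together with the lower bound 2^(c n^2) for A(n), coming
   from an array whose entries can be independently increased by 1, this gives
   B(N - 1) / B(N) <= C 2^(-N / 8).

   Let a = 8 (r + 1). Tuples without tau_min in which some t_k has at most a
   non-minimal rows are bounded by the choice of these rows and of one of them
   that is minimal in another triangle: a polynomial in N times B(N - 1) / B(N)^2
   in probability. In the remaining tuples, assigning to each row a triangle in
   which it is minimal and using log-convexity gives at most
   r^N B(a) B(N - a) / B(N)^2, and B(N - a) / B(N) decays like (2r)^(-N). *)

Set Implicit Arguments.
Unset Strict Implicit.
Unset Printing Implicit Defensive.

Import Order.TTheory GRing.Theory Num.Theory.
Import numFieldNormedType.Exports.

Local Open Scope nat_scope.

(** * Deletion of minimal rows *)

Definition cell n i j (ltin : i < n) (ltji : j < i.+1) : position n :=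
  Tagged (fun k : 'I_n => 'I_k.+1) (Ordinal ltji : 'I_(Ordinal ltin).+1).

(* Row and column indices are 0-based; the value outside the triangle is 0. *)
Definition entry n (t : array n) (i j : nat) : nat :=
  if @insub nat (fun k => k < n) 'I_n i is Some k then
    if @insub nat (fun l => l < k.+1) 'I_k.+1 j is Some l then
      t (Tagged (fun k : 'I_n => 'I_k.+1) l) else 0
  else 0.

Lemma entry_tag n (t : array n) (p : position n) :
  entry t (tag p) (tagged p) = t p.
Proof.
case: p => i j; rewrite /entry /=.
case: insubP => [k _ /val_inj ek|]; last by rewrite ltn_ord.
subst k; case: insubP => [l _ /val_inj el|]; last by rewrite ltn_ord.
by subst l.
Qed.

Lemma entry_cell n (t : array n) i j (ltin : i < n) (ltji : j < i.+1) :
  entry t i j = t (cell ltin ltji).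
Proof. by rewrite -entry_tag. Qed.

Lemma entry_inj n (t u : monotone_triangle n) :
  (forall i j, i < n -> j <= i -> entry t i j = entry u i j) -> t = u.
Proof.
move=> tu; apply/val_inj/ffunP => p /=; apply: val_inj => /=.
by rewrite -!entry_tag; apply: tu; [exact: ltn_ord | rewrite -ltnS; exact: ltn_ord].
Qed.

(** The inequalities of [is_monotone] for a function of plain indices, arbitrary outside the
    triangle. New triangles can then be given by arithmetic formulas. *)
Record triangle_spec n (F : nat -> nat -> nat) : Prop := TriangleSpec {
  triangle_gt0 : forall i j, i < n -> j <= i -> 0 < F i j;
  triangle_le : forall i j, i < n -> j <= i -> F i j <= n;
  triangle_row : forall i j, i < n -> j < i -> F i j < F i j.+1;
  triangle_up : forall i j, i.+1 < n -> j <= i -> F i.+1 j <= F i j;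
  triangle_down : forall i j, i.+1 < n -> j <= i -> F i j <= F i.+1 j.+1 }.

Lemma entry_spec n (t : monotone_triangle n) : triangle_spec n (entry t).
Proof.
case: t => t /= /and4P[/forallP t0 /forallP tr /forallP tu /forallP td].
split=> i j.
- by move=> lin lji; rewrite (entry_cell t lin lji).
- by move=> lin lji; rewrite (entry_cell t lin lji) -ltnS.
- move=> lin lji; have lji' : j < i.+1 by lia.
  rewrite (entry_cell t lin lji') (entry_cell t lin (lji : j.+1 < i.+1)).
  move: (forallP (tr (cell lin lji')) (cell lin (lji : j.+1 < i.+1))).
  by rewrite /pos_row /pos_col /= !eqxx.
- move=> lin lji; have lin' : i < n by lia. have lji' : j < i.+2 by lia.
  rewrite (entry_cell t lin lji') (entry_cell t lin' lji).
  move: (forallP (tu (cell lin lji')) (cell lin' lji)).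
  by rewrite /pos_row /pos_col /= !eqxx.
- move=> lin lji; have lin' : i < n by lia. have lji' : j.+1 < i.+2 by lia.
  rewrite (entry_cell t lin lji') (entry_cell t lin' lji).
  move: (forallP (td (cell lin lji')) (cell lin' lji)).
  by rewrite /pos_row /pos_col /= !eqxx.
Qed.

Definition triangle_array n (F : nat -> nat -> nat) : array n :=
  [ffun p : position n => inord (F (tag p) (tagged p))].

Lemma triangle_arrayE n F (p : position n) : triangle_spec n F ->
  triangle_array n F p = F (tag p) (tagged p) :> nat.
Proof.
move=> [_ F_le _ _ _]; rewrite ffunE inordK // ltnS; apply: F_le => //.
by rewrite -ltnS; exact: ltn_ord.
Qed.

Lemma triangle_array_monotone n F :
  triangle_spec n F -> is_monotone (triangle_array n F).
Proof.
move=> Fspec; have aE p := triangle_arrayE p Fspec.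
case: Fspec => F0 _ Fr Fu Fd.
have lt_pos (p : position n) : tag p < n /\ tagged p <= tag p.
  by split; [exact: ltn_ord | rewrite -ltnS; exact: ltn_ord].
apply/and4P; split; apply/forallP => p; have [p1 p2] := lt_pos p.
- by rewrite aE; apply: F0.
- apply/forallP => q; apply/implyP; rewrite /pos_row /pos_col => /andP[/eqP[e1] /eqP[e2]].
  have [q1 q2] := lt_pos q; rewrite !aE.
  rewrite (_ : F (tag q) _ = F (tag p) (tagged p).+1); last by congr F.
  by apply: Fr => //; rewrite -e2 -e1.
- apply/forallP => q; apply/implyP; rewrite /pos_row /pos_col => /andP[/eqP[e1] /eqP[e2]].
  have [q1 q2] := lt_pos q; rewrite !aE.
  rewrite (_ : F (tag p) _ = F (tag q).+1 (tagged q)); last by congr F.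
  by apply: Fu; rewrite -?e1.
- apply/forallP => q; apply/implyP; rewrite /pos_row /pos_col => /andP[/eqP[e1] /eqP[e2]].
  have [q1 q2] := lt_pos q; rewrite !aE.
  rewrite (_ : F (tag p) _ = F (tag q).+1 (tagged q).+1); last by congr F.
  by apply: Fd; rewrite -?e1.
Qed.

(* Junk value [tau_min n] when [F] does not satisfy [triangle_spec]. *)
Definition triangle n (F : nat -> nat -> nat) : monotone_triangle n :=
  insubd (tau_min n) (triangle_array n F).

Lemma entry_triangle n F i j : triangle_spec n F -> i < n -> j <= i ->
  entry (triangle n F) i j = F i j.
Proof.
move=> Fspec lin lji; rewrite (entry_cell _ lin lji) /triangle.
rewrite (insubdK (tau_min n) (triangle_array_monotone Fspec)).
by rewrite triangle_arrayE.
Qed.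

Lemma triangle_inj n F G : triangle_spec n F -> triangle_spec n G ->
  triangle n F = triangle n G -> forall i j, i < n -> j <= i -> F i j = G i j.
Proof.
move=> Fs Gs e i j lin lji; have := entry_triangle Fs lin lji.
by rewrite e (entry_triangle Gs lin lji) => {e} ->.
Qed.

Lemma entry_tau_min n i j : i < n -> j <= i -> entry (tau_min n) i j = j.+1.
Proof. by move=> lin lji; rewrite (entry_cell _ lin lji) tau_min_arrayE. Qed.

Lemma triangle_ge n F : triangle_spec n F ->
  forall i j, i < n -> j <= i -> j < F i j.
Proof.
case=> F0 _ Fr _ _ i; elim=> [|j IHj] lin lji; first exact: F0.
by apply: leq_ltn_trans (IHj lin (ltnW lji)) _; apply: Fr.
Qed.

Lemma triangle_le_col n F : triangle_spec n F ->
  forall i j, i < n -> j <= i -> F i j + (i - j) <= F i i.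
Proof.
case=> _ _ Fr _ _ i j lin lji; have [k ek] : exists k, i = j + k by exists (i - j); lia.
elim: k j lji ek => [|k IHk] j lji ek; first by rewrite ek addn0 subnn addn0.
have := IHk j.+1 _ _; have := Fr i j; lia.
Qed.

(* The last entry of a row being minimal forces the whole row to be minimal. *)
Definition row_min n (t : monotone_triangle n) (i : nat) : bool :=
  entry t i i == i.+1.

Lemma row_minE n (t : monotone_triangle n) i j : i < n -> j <= i ->
  row_min t i -> entry t i j = j.+1.
Proof.
move=> lin lji /eqP ti; have ts := entry_spec t.
have := triangle_ge ts lin lji; have := triangle_le_col ts lin lji; lia.
Qed.

Lemma row_min_below n (t : monotone_triangle n) i k j :
  i <= k -> k < n -> j <= i -> row_min t i -> entry t k j = j.+1.
Proof.
move=> lik lkn lji ti; have ts := entry_spec t.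
have [d ek] : exists d, k = i + d by exists (k - i); lia.
subst k; elim: d lkn {lik} => [|d IHd] lkn.
  by rewrite addn0 (row_minE _ _ ti) //; lia.
have := triangle_up ts (i := i + d) (j := j).
have := triangle_ge ts (i := i + d.+1) (j := j); rewrite addnS in lkn *; lia.
Qed.

Lemma row_min_last n (t : monotone_triangle n.+1) : row_min t n.
Proof.
have ts := entry_spec t; apply/eqP.
have := triangle_ge ts (ltnSn n) (leqnn n); have := triangle_le ts (ltnSn n) (leqnn n); lia.
Qed.

Lemma row_min_above n (t : monotone_triangle n) i k j :
  k < i -> i < n -> j <= k -> row_min t i -> entry t k j <= i.+1.
Proof.
move=> lki lin lji ti; have ts := entry_spec t.
have [d ei] : exists d, i = k + d.+1 by exists (i - k.+1); lia.
elim: d k j lki lji ei => [|d IHd] k j lki lji ei.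
  have := triangle_down ts (i := k) (j := j).
  rewrite -(_ : i = k.+1) ?(row_minE _ _ ti); lia.
have := triangle_down ts (i := k) (j := j).
have := IHd k.+1 j.+1; lia.
Qed.

Lemma row_min_tau_min n (t : monotone_triangle n.+1) :
  (forall i, i < n -> row_min t i) -> t = tau_min n.+1.
Proof.
move=> tm; apply: entry_inj => i j lin lji; rewrite entry_tau_min //.
apply: row_minE => //; move: lin; rewrite ltnS leq_eqVlt => /predU1P[->|/tm//].
exact: row_min_last.
Qed.

(* Delete the minimal row [i] together with the value [i.+1], which occurs in
   column [i] of every later row. *)
Definition delete_row (i : nat) (F : nat -> nat -> nat) (k j : nat) : nat :=
  if k < i then F k j else if j < i then j.+1 else (F k.+1 j.+1).-1.

(** The delicate place is the seam at row [i]: entries above it are at most [i.+1] by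
    [row_min_above], while the diagonal entry of row [i.+1] is at least [i.+2] and drops by one. *)
Lemma delete_row_spec n (t : monotone_triangle n.+1) i : i < n -> row_min t i ->
  triangle_spec n (delete_row i (entry t)).
Proof.
move=> lin ti; have ts := entry_spec t; have lin' : i < n.+1 by lia.
have ge := triangle_ge ts; case: (ts) => F0 Fl Fr Fu Fd.
have below k j := @row_min_below _ t i k j; have above k j := @row_min_above _ t i k j.
rewrite /delete_row; split=> k j lk lj.
- case: (ltnP k i) => ?; first by apply: F0; lia.
  by case: (ltnP j i) => // ?; have := ge k.+1 j.+1; lia.
- case: (ltnP k i) => ?; first by have := above k j; lia.
  by case: (ltnP j i) => ?; [lia | have := Fl k.+1 j.+1; lia].
- case: (ltnP k i) => ?; first by apply: Fr; lia.
  have := Fr k.+1 j.+1; have := ge k.+1 j.+1; have := ge k.+1 j.+2.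
  by case: (ltnP j i); case: (ltnP j.+1 i); lia.
- case: (ltnP k.+1 i) => ki1; first by rewrite (ltn_trans (ltnSn k) ki1); apply: Fu; lia.
  case: (ltnP k i) => ki; first by rewrite (_ : j < i) ?ge //; lia.
  case: (ltnP j i) => // ji; have := Fu k.+1 j.+1; lia.
- case: (ltnP k.+1 i) => ki1; first by rewrite (ltn_trans (ltnSn k) ki1); apply: Fd; lia.
  case: (ltnP k i) => ki.
    have := ge k.+2 j.+2; have := above k j; have := below k.+1 j.+1; have := Fd k j.
    by case: (ltnP j.+1 i); lia.
  have := ge k.+2 j.+2; have := Fd k.+1 j.+1.
  by case: (ltnP j.+1 i); case: (ltnP j i); lia.
Qed.

(** The lost entries lie in row [i] and in columns up to [i] of later rows, where minimality forces
    the value [j.+1]. All others can be read off, since [.-1] is injective on positive entries. *)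
Lemma delete_row_inj n (t u : monotone_triangle n.+1) i :
  i < n -> row_min t i -> row_min u i ->
  triangle n (delete_row i (entry t)) = triangle n (delete_row i (entry u)) -> t = u.
Proof.
move=> lin ti ui.
move/(triangle_inj (delete_row_spec lin ti) (delete_row_spec lin ui)) => E.
apply: entry_inj => k j lk lj.
have tge := triangle_ge (entry_spec t); have uge := triangle_ge (entry_spec u).
case: (ltngtP k i) => [lki|lik|eki].
- by have := E k j; rewrite /delete_row lki; apply; lia.
- case: (leqP j i) => lji; first by rewrite !(row_min_below (i := i)) //; lia.
  case: k j lk lj lik lji => [|k] [|j] // lk lj lik lji.
  have := E k j; rewrite /delete_row [k < i]ltnNge [i <= k]lik [j < i]ltnNge [i <= j]lji /=.
  have := tge k.+1 j.+1; have := uge k.+1 j.+1; lia.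
- by rewrite eki in lk lj *; rewrite !(row_minE _ _ _) //.
Qed.

(** The list is decreasing, so the largest row is deleted first; the remaining rows lie above it and
    keep their index and their minimality. *)
Lemma card_row_min n (s : seq nat) : sorted gtn s -> all (fun i => i < n) s ->
  #|[pred t : monotone_triangle n.+1 | all (row_min t) s]| <= A (n.+1 - size s).
Proof.
elim: s n => [|i s IHs] n ss sn; first by rewrite subn0 max_card.
case: n sn => [|n] /=; first by [].
move=> /andP[lin sn]; rewrite subSS.
have si : all (fun k => k < i) s.
  move: ss; rewrite /= path_sortedE => [/andP[]//|] a b c; rewrite /gtn /=; lia.
have ss' : sorted gtn s by exact: path_sorted ss.
have sn' : all (fun k => k < n) s.
  apply/allP => k /(allP si); lia.
apply: leq_trans (IHs n ss' sn').
have inj : {in [pred t : monotone_triangle n.+2 | row_min t i && all (row_min t) s] &,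
    injective (fun t : monotone_triangle n.+2 => triangle n.+1 (delete_row i (entry t)))}.
  move=> t u; rewrite !inE => /andP[ti _] /andP[ui _]; exact: delete_row_inj.
rewrite -(card_in_image inj); apply: subset_leq_card.
apply/fintype.subsetP => x /fintype.imageP[t].
rewrite inE => /andP[ti ts] ->; rewrite inE; apply/allP => k ks.
have lk : k < i by apply: (allP si).
rewrite /row_min entry_triangle //; [|exact: delete_row_spec|lia].
by rewrite /delete_row lk; apply: (allP ts).
Qed.

(** * Log-convexity *)

Fixpoint sum_bits (n : nat) (f : seq bool -> nat) : nat :=
  if n is n'.+1 then
    sum_bits n' (fun s => f (false :: s)) + sum_bits n' (fun s => f (true :: s))
  else f [::].

Lemma eq_sum_bits n f g : f =1 g -> sum_bits n f = sum_bits n g.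
Proof. by elim: n f g => [|n IHn] f g fg /=; [|congr (_ + _); apply: IHn => s]. Qed.

Lemma sum_bits0 n : sum_bits n (fun=> 0) = 0.
Proof. by elim: n => //= n ->. Qed.

Lemma sum_bitsD n f g :
  sum_bits n (fun s => f s + g s) = sum_bits n f + sum_bits n g.
Proof. by elim: n f g => //= n IHn f g; rewrite !IHn addnACA. Qed.

Lemma sum_bits_eq n (c : seq bool) : size c = n -> sum_bits n (fun s => c == s) = 1.
Proof.
elim: n c => [|n IHn] [|b c] //= [sc].
have E b' : sum_bits n (fun s => b :: c == b' :: s) = (b == b').
  case: (b =P b') => [->|bb'].
    by rewrite (@eq_sum_bits _ _ (fun s => c == s)) ?IHn // => s; rewrite eqseq_cons eqxx.
  rewrite (@eq_sum_bits _ _ (fun=> 0)) ?sum_bits0 // => s.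
  by rewrite eqseq_cons; case: eqP bb'.
by rewrite !E; case: (b).
Qed.

Lemma four_numbers (a0 a1 b0 b1 c0 c1 d0 d1 : nat) :
  a0 * b0 <= c0 * d0 -> a0 * b1 <= c1 * d0 -> a1 * b0 <= c1 * d0 ->
  a1 * b1 <= c1 * d1 -> (a0 + a1) * (b0 + b1) <= (c0 + c1) * (d0 + d1).
Proof.
move=> h00 h01 h10 h11.
(* The diagonal products are settled by [h00] and [h11]. For the mixed ones write [u], [v] on the
   left and [x], [y] on the right: [u] and [v] are at most [x] and [u * v <= x * y], so
   [(x - u)(x - v) >= 0] gives [u + v <= x + y]. *)
suff : a0 * b1 + a1 * b0 <= c1 * d0 + c0 * d1 by nia.
have : (a0 * b1) * (a1 * b0) <= (c1 * d0) * (c0 * d1) by have := leq_mul h00 h11; lia.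
move: h01 h10; move: (a0 * b1) (a1 * b0) (c1 * d0) (c0 * d1) => u v x y; nia.
Qed.

(** The Ahlswede-Daykin theorem on the Boolean cube. Fixing the first bits of both arguments and
    inducting yields the four hypotheses of [four_numbers]. *)
Lemma four_functions n (al be ga de : seq bool -> nat) :
  (forall s t, size s = n -> size t = n ->
     al s * be t <= ga [seq p.1 || p.2 | p <- zip s t]
                    * de [seq p.1 && p.2 | p <- zip s t]) ->
  sum_bits n al * sum_bits n be <= sum_bits n ga * sum_bits n de.
Proof.
elim: n al be ga de => [|n IHn] al be ga de h /=; first exact: (h [::] [::]).
apply: four_numbers; apply: IHn => s t ss st.
- by apply: (h (false :: s) (false :: t)); rewrite /= ?ss ?st.
- by apply: (h (false :: s) (true :: t)); rewrite /= ?ss ?st.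
- by apply: (h (true :: s) (false :: t)); rewrite /= ?ss ?st.
- by apply: (h (true :: s) (true :: t)); rewrite /= ?ss ?st.
Qed.

(** * Counting in finite lattices embedded in a Boolean cube *)

Section Daykin.
Variables (L : finType) (n : nat) (code : L -> seq bool) (join meet : L -> L -> L).
Hypothesis size_code : forall x, size (code x) = n.
Hypothesis code_inj : injective code.
Hypothesis code_join : forall x y,
  code (join x y) = [seq p.1 || p.2 | p <- zip (code x) (code y)].
Hypothesis code_meet : forall x y,
  code (meet x y) = [seq p.1 && p.2 | p <- zip (code x) (code y)].

Lemma sum_bits_code (X : pred L) :
  sum_bits n (fun s => [exists x, X x && (code x == s)]) = #|X|.
Proof.
rewrite (@eq_sum_bits _ _ (fun s => \sum_(x | X x) (code x == s))); last first.
  move=> s; case: existsP => [[x /andP[Xx /eqP <-]]|nX].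
    rewrite (bigD1 x) //= eqxx big1 // => y /andP[_ yx].
    by case: eqP => // /code_inj e; rewrite e eqxx in yx.
  rewrite big1 // => x Xx; case: eqP => // e.
  by case: nX; exists x; rewrite Xx e eqxx.
rewrite -sum1_card.
elim: (index_enum L) => [|x l IHl].
  by rewrite big_nil -[RHS](sum_bits0 n); apply: eq_sum_bits => s; rewrite big_nil.
rewrite big_cons -IHl; case: ifP => Xx; last first.
  by apply: eq_sum_bits => s; rewrite big_cons (_ : X x = false).
rewrite -(sum_bits_eq (size_code x)) -sum_bitsD.
by apply: eq_sum_bits => s; rewrite big_cons (_ : X x = true).
Qed.

Lemma daykin (X Y U V : pred L) :
  (forall x y, X x -> Y y -> U (join x y) && V (meet x y)) ->
  #|X| * #|Y| <= #|U| * #|V|.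
Proof.
move=> XYUV; rewrite -!sum_bits_code; apply: four_functions => s t _ _.
case: existsP => // -[x /andP[Xx /eqP <-]]; case: existsP => // -[y /andP[Yy /eqP <-]].
have /andP[Uxy Vxy] := XYUV _ _ Xx Yy.
rewrite -code_join -code_meet.
case: existsP => [_|[]]; last by exists (join x y); rewrite Uxy eqxx.
by case: existsP => // -[]; exists (meet x y); rewrite Vxy eqxx.
Qed.
End Daykin.

(** * The distributive lattice of monotone triangles *)

Definition join_mt n (t u : monotone_triangle n) : monotone_triangle n :=
  triangle n (fun i j => maxn (entry t i j) (entry u i j)).
Definition meet_mt n (t u : monotone_triangle n) : monotone_triangle n :=
  triangle n (fun i j => minn (entry t i j) (entry u i j)).

Lemma join_spec n (t u : monotone_triangle n) :
  triangle_spec n (fun i j => maxn (entry t i j) (entry u i j)).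
Proof.
have [t0 tl tr tu td] := entry_spec t; have [u0 ul ur uu ud] := entry_spec u.
split=> i j li lj.
- by have := t0 i j li lj; lia.
- by have := tl i j li lj; have := ul i j li lj; lia.
- by have := tr i j li lj; have := ur i j li lj; lia.
- by have := tu i j li lj; have := uu i j li lj; lia.
- by have := td i j li lj; have := ud i j li lj; lia.
Qed.

Lemma meet_spec n (t u : monotone_triangle n) :
  triangle_spec n (fun i j => minn (entry t i j) (entry u i j)).
Proof.
have [t0 tl tr tu td] := entry_spec t; have [u0 ul ur uu ud] := entry_spec u.
split=> i j li lj.
- by have := t0 i j li lj; have := u0 i j li lj; lia.
- by have := tl i j li lj; lia.
- by have := tr i j li lj; have := ur i j li lj; lia.
- by have := tu i j li lj; have := uu i j li lj; lia.
- by have := td i j li lj; have := ud i j li lj; lia.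
Qed.

Lemma join_mtE n (t u : monotone_triangle n) p : join_mt t u p = maxn (t p) (u p) :> nat.
Proof.
rewrite -entry_tag entry_triangle ?entry_tag //; first exact: join_spec.
by rewrite -ltnS; exact: ltn_ord.
Qed.

Lemma meet_mtE n (t u : monotone_triangle n) p : meet_mt t u p = minn (t p) (u p) :> nat.
Proof.
rewrite -entry_tag entry_triangle ?entry_tag //; first exact: meet_spec.
by rewrite -ltnS; exact: ltn_ord.
Qed.

(** Unary coding of the entries by thresholds turns maxima into disjunctions and minima into
    conjunctions. *)
Definition code_mt n (t : monotone_triangle n) : seq bool :=
  [seq nat_of_ord c.2 < t c.1 | c <- enum {: position n * 'I_n.+1}].

Lemma code_mt_inj n : injective (@code_mt n).
Proof.
move=> t u /eq_in_map e; apply/val_inj/ffunP => p /=; apply: val_inj => /=.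
have E c : (c < n.+1) -> (c < t p) = (c < u p).
  by move=> lc; have := e (p, Ordinal lc); apply; rewrite mem_enum.
have := E _ (ltn_ord (t p)); have := E _ (ltn_ord (u p)); rewrite !ltnn => e1 e2.
by case: ltngtP e1 e2.
Qed.

Lemma code_join n (t u : monotone_triangle n) :
  code_mt (join_mt t u) = [seq p.1 || p.2 | p <- zip (code_mt t) (code_mt u)].
Proof.
rewrite /code_mt zip_map -map_comp; apply: eq_map => c /=.
by rewrite join_mtE leq_max.
Qed.

Lemma code_meet n (t u : monotone_triangle n) :
  code_mt (meet_mt t u) = [seq p.1 && p.2 | p <- zip (code_mt t) (code_mt u)].
Proof.
rewrite /code_mt zip_map -map_comp; apply: eq_map => c /=.
by rewrite meet_mtE leq_min.
Qed.

Lemma row_min_meet n (t u : monotone_triangle n) i : i < n ->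
  row_min t i || row_min u i -> row_min (meet_mt t u) i.
Proof.
move=> lin; rewrite /row_min entry_triangle //; last exact: meet_spec.
have := triangle_ge (entry_spec t) lin (leqnn i).
have := triangle_ge (entry_spec u) lin (leqnn i); lia.
Qed.

(** Inverse of [delete_row 0]: a first column of ones is added and the old triangle is shifted by
    one in row, column and value. *)
Definition add_first_row (F : nat -> nat -> nat) (i j : nat) : nat :=
  if j is j'.+1 then (F i.-1 j').+1 else 1.

Lemma add_first_row_spec n (t : monotone_triangle n) :
  triangle_spec n.+1 (add_first_row (entry t)).
Proof.
have [t0 tl tr tu td] := entry_spec t.
split=> -[|i] [|j] //= li lj; rewrite ltnS.
- by apply: tl; lia.
- by apply: t0; lia.
- by apply: tr; lia.
- by apply: tu; lia.
- by apply: td; lia.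
Qed.

Lemma card_row_min_first n :
  A n <= #|[pred t : monotone_triangle n.+1 | row_min t 0]|.
Proof.
have inj : injective (fun t : monotone_triangle n =>
    triangle n.+1 (add_first_row (entry t))).
  move=> t u /(triangle_inj (add_first_row_spec t) (add_first_row_spec u)) E.
  by apply: entry_inj => i j lin lji; have := E i.+1 j.+1 lin lji => -[].
rewrite /A -(card_codom inj); apply: subset_leq_card.
apply/fintype.subsetP => _ /codomP[t ->]; rewrite inE /row_min entry_triangle //.
exact: add_first_row_spec.
Qed.

(** The old last row is necessarily [1, ..., n], so it becomes a minimal last but one row. *)
Definition add_last_row (n : nat) (F : nat -> nat -> nat) (i j : nat) : nat :=
  if i < n then F i j else j.+1.

Lemma add_last_row_spec n (t : monotone_triangle n) :
  triangle_spec n.+1 (add_last_row n (entry t)).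
Proof.
have [t0 tl tr tu td] := entry_spec t; have ge := triangle_ge (entry_spec t).
rewrite /add_last_row; split=> i j li lj.
- by case: (ltnP i n) => // lin; apply: t0.
- by case: (ltnP i n) => lin; [have := tl i j lin lj; lia | lia].
- by case: (ltnP i n) => // lin; apply: tr.
- rewrite (_ : i < n); last lia.
  by case: (ltnP i.+1 n) => lin; [apply: tu | apply: ge].
- rewrite (_ : i < n); last lia.
  case: (ltnP i.+1 n) => lin; first by apply: td.
  have en : n = i.+1 by lia.
  by subst n; rewrite (row_minE _ _ (row_min_last t)).
Qed.

Lemma card_row_min_last n :
  A n.+1 <= #|[pred t : monotone_triangle n.+2 | row_min t n]|.
Proof.
have inj : injective (fun t : monotone_triangle n.+1 =>
    triangle n.+2 (add_last_row n.+1 (entry t))).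
  move=> t u /(triangle_inj (add_last_row_spec t) (add_last_row_spec u)) E.
  apply: entry_inj => i j lin lji; have := E i j (leqW lin) lji.
  by rewrite /add_last_row lin.
rewrite [X in X <= _]/A -(card_codom inj); apply: subset_leq_card.
apply/fintype.subsetP => _ /codomP[t ->]; rewrite inE /row_min entry_triangle //.
  by rewrite /add_last_row ltnSn; exact: row_min_last.
exact: add_last_row_spec.
Qed.

(** In size [n.+2], rows [0] and [n] are each minimal in at least [A n.+1] triangles. The meet of
    one triangle of each kind has both rows minimal, which happens for at most [A n] triangles;
    [0 < n] keeps the two rows distinct. *)
Lemma A_log_convex n : 0 < n -> A n.+1 ^ 2 <= A n * A n.+2.
Proof.
move=> n_gt0.
apply: leq_trans (_ : #|[pred t : monotone_triangle n.+2 | row_min t 0]| *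
  #|[pred t : monotone_triangle n.+2 | row_min t n]| <= _).
  by rewrite expnS expn1 leq_mul ?card_row_min_first ?card_row_min_last.
apply: leq_trans (_ : #|[pred t : monotone_triangle n.+2 | true]| *
  #|[pred t : monotone_triangle n.+2 | all (row_min t) [:: n; 0]]| <= _).
  apply: (daykin (code := @code_mt n.+2) (n := size (enum {: position n.+2 * 'I_n.+3}))
            (join := @join_mt _) (meet := @meet_mt _)).
  - by move=> t; rewrite size_map.
  - exact: code_mt_inj.
  - exact: code_join.
  - exact: code_meet.
  - move=> t u /= t0 un.
    by rewrite row_min_meet ?un ?orbT // row_min_meet ?t0.
rewrite mulnC; apply: leq_mul; last exact: max_card.
rewrite -[X in _ <= A X](addnK 2) addn2; apply: card_row_min; first by rewrite /= n_gt0.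
by rewrite /= ltnSn.
Qed.

Lemma A_gt0 n : 0 < A n.
Proof. by apply/card_gt0P; exists (tau_min n). Qed.

Lemma A_leS n : A n <= A n.+1.
Proof. exact: leq_trans (card_row_min_first n) (max_card _). Qed.

(** * Growth *)

(** Raise [N <= q * (N %/ q).+1 <= q * 2 ^ (N %/ q)] to the power [q]. *)
Lemma expn_le_exp2 N q : 0 < q -> N ^ q <= q ^ q * 2 ^ N.
Proof.
move=> q_gt0; apply: leq_trans (_ : (q * 2 ^ (N %/ q)) ^ q <= _).
  rewrite leq_exp2r //; apply: leq_trans (_ : q * (N %/ q).+1 <= _).
    by rewrite mulnC ltnW // ltn_ceil.
  by rewrite leq_mul // ltn_expl.
by rewrite expnMn -expnM leq_mul // leq_exp2l // leq_divM.
Qed.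

Section LogConvex.
Variable B : nat -> nat.
Hypothesis B_gt0 : forall n, 0 < B n.
Hypothesis B_log_convex : forall n, B n.+1 ^ 2 <= B n * B n.+2.

Lemma log_convex_ratio m n : m <= n -> B m.+1 * B n <= B m * B n.+1.
Proof.
move=> /subnKC <-; elim: (n - m) => [|d IHd]; first by rewrite addn0 mulnC.
rewrite !addnS; have := B_log_convex (m + d); rewrite expnS expn1 => lc.
rewrite -(leq_pmul2r (B_gt0 (m + d))).
apply: leq_trans (_ : B m * (B (m + d).+1 * B (m + d).+1) <= _).
  by have := leq_mul IHd (leqnn (B (m + d).+1)); lia.
by have := leq_mul (leqnn (B m)) lc; lia.
Qed.

Lemma log_convex_shift m n d : m <= n -> B (m + d) * B n <= B m * B (n + d).
Proof.
move=> mn; elim: d => [|d IHd]; first by rewrite !addn0.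
rewrite !addnS -(leq_pmul2r (B_gt0 (m + d))) -(leq_pmul2r (B_gt0 (n + d))).
have := leq_mul IHd (log_convex_ratio (leq_add mn (leqnn d))); lia.
Qed.

Lemma log_convex_merge N x y : x + y <= N ->
  B (N - x) * B (N - y) <= B (N - (x + y)) * B N.
Proof.
move=> xyN; have /(@log_convex_shift _ _ x) : N - (x + y) <= N - x by lia.
have -> : N - (x + y) + x = N - y by lia.
by rewrite [B (N - y) * _]mulnC subnK //; lia.
Qed.

(** [log_convex_merge] pushes two indices apart while keeping their sum; repeating it collects all
    deficits [s k] in a single factor. *)
Lemma log_convex_prod (I : Type) (l : seq I) (s : I -> nat) N :
  \sum_(k <- l) s k <= N ->
  (\prod_(k <- l) B (N - s k)) * B N <= B (N - \sum_(k <- l) s k) * B N ^ size l.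
Proof.
elim: l => [|k l IHl]; first by rewrite !big_nil subn0 expn0 mul1n muln1.
rewrite !big_cons /= expnS => sN; have /IHl {}IHl : \sum_(j <- l) s j <= N by lia.
have := leq_mul (leqnn (B (N - s k))) IHl.
have := leq_mul (log_convex_merge sN) (leqnn (B N ^ size l)); lia.
Qed.

Lemma log_convex_balance N a s : a <= s -> a <= N - s -> s <= N ->
  B s * B (N - s) <= B a * B (N - a).
Proof.
move=> las laNs lsN; have := @log_convex_shift a (N - s) (s - a) laNs.
have -> : a + (s - a) = s by lia.
by have -> : N - s + (s - a) = N - a by lia.
Qed.

(** Since [B 0 = 1], [B j] is the product of the first [j] ratios [B i.+1 / B i], each at most
    [B N.+1 / B N]. *)
Lemma log_convex_exp N j : B 0 = 1 -> j <= N.+1 -> B j * B N ^ j <= B N.+1 ^ j.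
Proof.
move=> B0; elim: j => [|j IHj] jN; first by rewrite B0.
rewrite !expnS.
have := leq_mul (log_convex_ratio (_ : j <= N)) (leqnn (B N ^ j)).
have := leq_mul (IHj (ltnW jN)) (leqnn (B N.+1)); lia.
Qed.

Lemma log_convex_growth k j : B k.+1 ^ j * B k <= B (k + j) * B k ^ j.
Proof.
elim: j => [|j IHj]; first by rewrite !expn0 addn0 mulnC.
rewrite !expnS addnS.
have := leq_mul (log_convex_ratio (leq_addr j k)) (leqnn (B k ^ j)).
have := leq_mul IHj (leqnn (B k.+1)); lia.
Qed.

Hypothesis B0 : B 0 = 1.
Hypothesis B_lower : forall n, 2 ^ (n * n.-2) <= B n ^ 8.

(** By [log_convex_exp], [B n.+1] is at most the [n.+1]-st power of the ratio [B n.+1 / B n]; taking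
    roots in [B_lower] gives [2 ^ n.-1] below its eighth power. The factor 4 raises the exponent to
    [n.+1] and absorbs the case [n = 0]. *)
Lemma ratio_lower n : 2 ^ n.+1 * B n ^ 8 <= 4 * B n.+1 ^ 8.
Proof.
have le : 2 ^ n.-1 * B n ^ 8 <= B n.+1 ^ 8.
  rewrite -(@leq_exp2r _ _ n.+1) // expnMn -!expnM.
  apply: leq_trans (_ : (B n.+1 * B n ^ n.+1) ^ 8 <= _).
    by rewrite expnMn -expnM [8 * n.+1]mulnC [n.-1 * _]mulnC leq_mul // (B_lower n.+1).
  rewrite [8 * _]mulnC expnM leq_exp2r //; exact: log_convex_exp.
case: n le => [|n] le; first by move: le; rewrite expn0 expn1; lia.
by rewrite 2!expnS -mulnA -mulnA mulnA leq_mul.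
Qed.

Lemma ratio_superpoly p : exists K, forall N, N.+1 ^ p.+1 * B N <= K * B N.+1.
Proof.
(* The comparison is made between eighth powers, where [N.+1 ^ q] is absorbed by the [2 ^ N.+1] of
   [ratio_lower]. *)
set q := 8 * p.+1; exists (4 * q ^ q) => N.
rewrite -(@leq_exp2r _ _ 8) //.
apply: leq_trans (_ : 4 * q ^ q * B N.+1 ^ 8 <= _); last first.
  rewrite expnMn leq_mul // -[X in X <= _]expn1 leq_pexp2l //.
  by rewrite muln_gt0 /= expn_gt0.
rewrite expnMn -expnM [p.+1 * 8]mulnC -/q.
have := leq_mul (expn_le_exp2 N.+1 (_ : 0 < q)) (leqnn (B N ^ 8)).
have := leq_mul (ratio_lower N) (leqnn (q ^ q)); rewrite /q; lia.
Qed.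

(** With [b = r.+1] and [k = N - 8 * b], [B N / B k] is at least the [8 * b]-th power of the ratio
    at [k], hence at least [2 ^ (k.+1 * b) / 4 ^ b]. This beats
    [r ^ N * N <= (2 * r) ^ N <= 2 ^ (b * N)] up to a constant. *)
Lemma ratio_superexp r : exists K, forall N, 8 * r.+1 <= N ->
  r ^ N * N * B (N - 8 * r.+1) <= K * B N.
Proof.
set b := r.+1; exists (2 ^ (8 * b * b) * 4 ^ b) => N leN.
set k := N - 8 * b; have eN : N = k + 8 * b by rewrite subnK.
have h : 2 ^ (k.+1 * b) * B k <= 4 ^ b * B N.
  have Bk : 0 < B k ^ (8 * b) by rewrite expn_gt0 B_gt0.
  rewrite -(leq_pmul2r Bk).
  have := log_convex_growth k (8 * b); rewrite -eN => g.
  have : (2 ^ k.+1 * B k ^ 8) ^ b <= (4 * B k.+1 ^ 8) ^ b.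
    by rewrite leq_exp2r // ratio_lower.
  rewrite (expnMn (2 ^ _)) (expnMn 4) -!expnM => e.
  have := leq_mul e (leqnn (B k)); have := leq_mul g (leqnn (4 ^ b)).
  move: (2 ^ _) (4 ^ _) (B k ^ _) (B k.+1 ^ _) => x y z w; lia.
apply: leq_trans (_ : 2 ^ (8 * b * b) * (2 ^ (k.+1 * b) * B k) <= _); last first.
  by rewrite -[X in _ <= X]mulnA leq_mul.
rewrite mulnA leq_mul // -expnD.
apply: leq_trans (_ : r ^ N * 2 ^ N <= _); first by rewrite leq_mul // ltnW // ltn_expl.
rewrite -expnMn; apply: leq_trans (_ : (2 ^ b) ^ N <= _).
  by case: (N) => // N'; rewrite leq_exp2r // expnS mulnC leq_mul // ltnW // ltn_expl.
by rewrite -expnM leq_exp2l // eN; lia.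
Qed.
End LogConvex.

(** * A lower bound for the number of monotone triangles *)

Lemma position_inj n (p q : position n) :
  tag p = tag q :> nat -> tagged p = tagged q :> nat -> p = q.
Proof.
case: p q => [i j] [k l] /= /val_inj e; subst k => /val_inj e.
by rewrite e.
Qed.

Definition cell_bit n (e : {ffun position n -> bool}) (i j : nat) : bool :=
  [exists p : position n, [&& nat_of_ord (tag p) == i, nat_of_ord (tagged p) == j & e p]].

Lemma cell_bitE n (e : {ffun position n -> bool}) (p : position n) :
  cell_bit e (tag p) (tagged p) = e p.
Proof.
apply/existsP/idP => [[q /and3P[/eqP qi /eqP qj]]|ep].
  by rewrite (position_inj qi qj).
by exists p; rewrite !eqxx.
Qed.

(* In 1-based coordinates [c + 2j - i + e(i, j)] satisfies the inequalities of a
   monotone triangle for every choice of bits [e]; it is then clipped to the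
   range [j, n - i + j]. *)
Definition bits_triangle (n c : nat) (e : nat -> nat -> bool) (i j : nat) : nat :=
  j.+1 + (minn (c + j.+1 + e i j) n - i.+1).

Lemma bits_triangle_spec n c e : triangle_spec n (bits_triangle n c e).
Proof.
by rewrite /bits_triangle; split=> i j li lj; lia. Qed.

Lemma card_position n : #|{: position n}|.*2 = n * n.+1.
Proof.
rewrite card_tagged sumnE big_map big_enum /=.
rewrite (eq_bigr (fun i : 'I_n => i.+1)); last by move=> i _; rewrite card_ord.
elim: n => [|n IHn]; first by rewrite big_ord0.
by rewrite big_ord_recr /= doubleD IHn; lia.
Qed.

(** With [c = n./2] the clipping is inactive in the first [(n./2).-1] rows, because
    [c + j.+1 + 1 <= n] there, so the bits can be recovered from the triangle. *)
Lemma A_lower_position n : 2 ^ #|{: position (n./2).-1}| <= A n.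
Proof.
set m := n./2; have m2 : m.*2 <= n by rewrite -[X in _ <= X]odd_double_half leq_addl.
have inj : injective (fun e : {ffun position m.-1 -> bool} =>
    triangle n (bits_triangle n m (cell_bit e))).
  move=> e f /(triangle_inj (bits_triangle_spec _ _ _) (bits_triangle_spec _ _ _)) E.
  have recover i j (b b' : bool) : i < m.-1 -> j < i.+1 ->
      j.+1 + (minn (m + j.+1 + b) n - i.+1) = j.+1 + (minn (m + j.+1 + b') n - i.+1) ->
      b = b' by case: b; case: b'; lia.
  apply/ffunP => p; have lj := ltn_ord (tagged p); have li := ltn_ord (tag p).
  apply: (recover _ _ _ _ li lj); rewrite -!(cell_bitE _ p).
  by apply: E; [apply: leq_trans li _; lia | rewrite -ltnS].
by rewrite -card_bool -card_ffun -(card_codom inj) max_card.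
Qed.

(** The last row is always minimal, so size [n.+1] leaves [n] free rows. Prescribing [k] of them as
    minimal then corresponds to [B (n - k)], and [B 0 = 1]. *)
Definition B n := A n.+1.

Lemma B_gt0 n : 0 < B n. Proof. exact: A_gt0. Qed.

Lemma B_log_convex n : B n.+1 ^ 2 <= B n * B n.+2. Proof. exact: A_log_convex. Qed.

(** The eighth power clears the fractions: with [m = n.+1./2], at least [n / 2], eight times the
    number of bits is [4 * m * (m - 1) >= n * (n - 2)]. *)
Lemma B_lower n : 2 ^ (n * n.-2) <= B n ^ 8.
Proof.
apply: leq_trans (_ : (2 ^ #|{: position (n.+1./2).-1}|) ^ 8 <= _); last first.
  by rewrite leq_exp2r // A_lower_position.
rewrite -expnM leq_exp2l //; have := card_position (n.+1./2).-1.
have := odd_double_half n.+1; move: (n.+1./2) (#|_|) => m c; nia.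
Qed.

Lemma B_le m n : m <= n -> B m <= B n.
Proof.
move=> /subnKC <-; elim: (n - m) => [|d IHd]; first by rewrite addn0.
by rewrite addnS (leq_trans IHd) // A_leS.
Qed.

Lemma B0 : B 0 = 1.
Proof.
apply/eqP; rewrite eqn_leq B_gt0 andbT.
apply: leq_trans (_ : #|pred1 (tau_min 1)| <= _); last by rewrite card1.
apply: subset_leq_card; apply/fintype.subsetP => t _; rewrite inE.
by apply/eqP; apply: row_min_tau_min.
Qed.

(** * Counting tuples with minimal infimum *)

Section Counting.
Local Open Scope set_scope.

Lemma card_ffun_forall (I T : finType) (F : I -> pred T) :
  #|[pred f : {ffun I -> T} | [forall k, F k (f k)]]| = \prod_k #|[pred x | F k x]|.
Proof.
have -> : #|[pred f : {ffun I -> T} | [forall k, F k (f k)]]| =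
    #|family (fun k => [pred x | F k x])|.
  by apply: eq_card => f; rewrite !inE.
by rewrite card_family foldrE big_map big_enum.
Qed.

(** [G] is a type of witnesses; the factor [b] allows the bound [c / b] for each witness without
    dividing. *)
Lemma union_bound (T G : finType) (X : pred T) (P : G -> pred T) (b c : nat) :
  (forall x, X x -> exists g, P g x) -> (forall g, #|[pred x | P g x]| * b <= c) ->
  #|[pred x | X x]| * b <= #|G| * c.
Proof.
move=> XP Pc; apply: leq_trans (_ : (\sum_g #|[pred x | P g x]|) * b <= _); last first.
  rewrite big_distrl /= -sum_nat_const; exact: leq_sum.
rewrite leq_mul2r; apply/orP; right.
rewrite (eq_bigr (fun g => \sum_x (P g x : nat))); last first.
  by move=> g _; rewrite -sum1_card big_mkcond.
rewrite exchange_big /= -sum1_card big_mkcond; apply: leq_sum => x _.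
case: ifP => // /XP[g Pgx]; rewrite (bigD1 g) //= Pgx; lia.
Qed.

Lemma prod_two_le (I : finType) (c : I -> nat) (a : nat) (k j : I) : k != j ->
  (forall l, l != k -> l != j -> c l <= a) ->
  (\prod_l c l) * a ^ 2 <= c k * c j * a ^ #|I|.
Proof.
move=> kj ca; rewrite -prod_nat_const (bigD1 k) //= (bigD1 j) 1?eq_sym //=.
rewrite [X in _ <= _ * X](bigD1 k) //= [X in _ <= _ * (_ * X)](bigD1 j) 1?eq_sym //=.
have : \prod_(i | (i != k) && (i != j)) c i <= \prod_(i | (i != k) && (i != j)) a.
  by apply: leq_prod => l /andP[lk lj]; exact: ca.
move: (\prod_(_ | _) c _) (\prod_(_ | _) a) => x y xy.
have := leq_mul (leqnn (c k * c j * (a * a))) xy; rewrite expnS expn1; lia.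
Qed.

Definition min_rows N (t : monotone_triangle N.+1) : {set 'I_N} :=
  [set i : 'I_N | row_min t i].

Lemma card_min_rows N (S : {set 'I_N}) :
  #|[pred t : monotone_triangle N.+1 | S \subset min_rows t]| <= B (N - #|S|).
Proof.
set s := sort geq (map val (enum S)).
have s_sorted : sorted gtn s.
  rewrite gtn_sorted_uniq_geq sort_uniq map_inj_uniq ?enum_uniq; last exact: val_inj.
  by apply: sort_sorted => x y; rewrite /geq /=; lia.
have s_lt : all (fun i => i < N) s.
  by apply/allP => i; rewrite mem_sort => /mapP[j _ ->]; exact: ltn_ord.
have := card_row_min s_sorted s_lt.
rewrite size_sort size_map -cardE subSn; last by rewrite -[X in _ <= X]card_ord max_card.
apply: leq_trans; apply: subset_leq_card; apply/fintype.subsetP => t.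
rewrite !inE => /fintype.subsetP St; apply/allP => i.
by rewrite mem_sort => /mapP[j]; rewrite mem_enum => /St; rewrite inE => ? ->.
Qed.

(** A map [g] from ['I_a] lists rows that include all non-minimal ones. At least [N - a] rows
    outside its image are minimal, which leaves at most [B a] triangles per map. *)
Lemma card_few_nonmin N a :
  #|[pred t : monotone_triangle N.+1 | 0 < #|~: min_rows t| <= a]| <= N ^ a * B a.
Proof.
have -> : N ^ a = #|{: {ffun 'I_a -> 'I_N}}| by rewrite card_ffun !card_ord.
rewrite -[X in X <= _]muln1.
apply: (union_bound (P := fun (g : {ffun 'I_a -> 'I_N}) t =>
    ~: (g @: [set: 'I_a]) \subset min_rows t)).
  move=> t /= /andP[/card_gt0P[i0 _] le_a].
  (* When there are fewer than [a] non-minimal rows, the last one is repeated. *)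
  exists [ffun k : 'I_a => nth i0 (enum (~: min_rows t)) (minn k #|~: min_rows t|.-1)].
  apply/fintype.subsetP => i; rewrite inE; apply: contraR => ti.
  have ie : i \in enum (~: min_rows t) by rewrite mem_enum inE.
  have := ie; rewrite -index_mem -cardE => lt_i.
  apply/imsetP; exists (Ordinal (leq_trans lt_i le_a)); first by rewrite inE.
  rewrite ffunE /= (minn_idPl _); first by rewrite nth_index.
  by rewrite -ltnS prednK //; apply: leq_ltn_trans lt_i.
move=> g; rewrite muln1; apply: leq_trans (card_min_rows _) _; apply: B_le.
rewrite -[X in X - _](card_ord N) -(cardsC (g @: [set: 'I_a])) addnK.
by apply: leq_trans (leq_imset_card _ _) _; rewrite cardsT card_ord.
Qed.

Definition bad_tuple r N (t : {ffun 'I_r -> monotone_triangle N.+1}) : bool :=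
  [forall i : 'I_N, exists k, row_min (t k) i] &&
  [forall k, t k != tau_min N.+1].

(** The witness is [(k, j, i)]: [t k] has few non-minimal rows, [i] is one of them, and [t j] is a
    different triangle in which row [i] is minimal. The remaining triangles are unrestricted. *)
Lemma card_bad_tuple_few r N a :
  #|[pred t : {ffun 'I_r -> monotone_triangle N.+2} |
      bad_tuple t && [exists k, #|~: min_rows (t k)| <= a]]| * B N.+1 ^ 2
  <= r * r * N.+1 * (N.+1 ^ a * B a * B N * B N.+1 ^ r).
Proof.
pose F (g : 'I_r * 'I_r * 'I_N.+1) l (x : monotone_triangle N.+2) :=
  if l == g.1.1 then 0 < #|~: min_rows x| <= a
  else if l == g.1.2 then row_min x g.2 else true.
have -> : r * r * N.+1 = #|{: 'I_r * 'I_r * 'I_N.+1}| by rewrite !card_prod !card_ord.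
apply: (union_bound (P := fun g (t : {ffun _}) =>
    (g.1.1 != g.1.2) && [forall l, F g l (t l)])).
  move=> t /= /andP[/andP[/forallP cov /forallP nmin] /existsP[k le_a]].
  have : 0 < #|~: min_rows (t k)|.
    rewrite lt0n; apply: contra (nmin k) => /eqP/cards0_eq e.
    apply/eqP/row_min_tau_min => i lt_i.
    have := finset.in_setC (Ordinal lt_i) (min_rows (t k)); rewrite e !inE.
    by case: row_min.
  move=> gt0; case/card_gt0P: (gt0) => i; rewrite !inE => ki.
  have /existsP[j ji] := cov i; exists (k, j, i) => /=.
  have kj : k != j by apply: contraNneq ki => ->.
  rewrite kj; apply/forallP => l; rewrite /F /=.
  case: eqP => [->|_]; first by rewrite gt0 le_a.
  by case: eqP => [->|].
move=> [[k j] i] /=; case: (eqVneq k j) => [_|kj] /=.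
  by rewrite (eq_card0 (A := [pred _ | false])).
rewrite card_ffun_forall; apply: leq_trans (prod_two_le kj _) _.
  by move=> *; exact: max_card.
rewrite card_ord leq_mul2r; apply/orP; right; apply: leq_mul.
  apply: leq_trans (card_few_nonmin N.+1 a); apply: subset_leq_card.
  by apply/fintype.subsetP => x; rewrite !inE /F /= eqxx.
apply: leq_trans (_ : B (N.+1 - #|[set i]|) <= _); last by rewrite cards1 subn1.
apply: leq_trans (card_min_rows [set i]); apply: subset_leq_card.
apply/fintype.subsetP => x; rewrite !inE /F /= eq_sym (negbTE kj) eqxx => xi.
by rewrite finset.sub1set inE.
Qed.

(** The witness [f] sends each row to a triangle in which it is minimal. Its fibres [S f k] have
    sizes summing to [N], and each has at most [N - a] elements because every triangle has more than
    [a] non-minimal rows. *)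
Lemma card_bad_tuple_many r N a : 0 < r -> 0 < a -> r * a <= N ->
  #|[pred t : {ffun 'I_r -> monotone_triangle N.+1} |
      bad_tuple t && [forall k, a < #|~: min_rows (t k)|]]| * B N ^ 2
  <= r ^ N * (B a * B (N - a) * B N ^ r).
Proof.
move=> r_gt0 a_gt0 raN.
have -> : r ^ N = #|{: {ffun 'I_N -> 'I_r}}| by rewrite card_ffun !card_ord.
pose S (f : {ffun 'I_N -> 'I_r}) k := [set i | f i == k].
apply: (union_bound (P := fun f (t : {ffun _}) => [forall k, #|S f k| <= N - a] &&
    [forall k, S f k \subset min_rows (t k)])).
  move=> t /= /andP[/andP[/forallP cov _] /forallP many].
  exists [ffun i : 'I_N => odflt (Ordinal r_gt0) [pick k | row_min (t k) i]].
  set f := finfun _.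
  have St k : S f k \subset min_rows (t k).
    apply/fintype.subsetP => i; rewrite !inE ffunE => /eqP <-.
    by case: pickP => //= no; have /existsP[j] := cov i; rewrite no.
  apply/andP; split; apply/forallP => k //.
  apply: leq_trans (subset_leq_card (St k)) _.
  by rewrite cardsCs card_ord leq_sub2l // ltnW // many.
move=> f; case: (boolP [forall k, #|S f k| <= N - a]) => [/forallP small|_] /=; last first.
  by rewrite (eq_card0 (A := [pred _ | false])).
rewrite (card_ffun_forall (fun k x => S f k \subset min_rows x)).
have sumS : \sum_k #|S f k| = N.
  rewrite (eq_bigr (fun k => \sum_i (f i == k : nat))); last first.
    by move=> k _; rewrite -sum1dep_card big_mkcond.
  rewrite exchange_big /= (eq_bigr (fun=> 1)) ?sum1_card ?card_ord // => i _.
  rewrite (bigD1 (f i)) //= eqxx big1 ?addn0 // => k kf.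
  by rewrite eq_sym (negbTE kf).
(* Pigeonhole: fibres all smaller than [a] would cover fewer than [r * a <= N] rows. *)
have [k0 large] : exists k0, a <= #|S f k0|.
  apply/existsP; apply: contraT; rewrite negb_exists => /forallP none.
  have : \sum_k #|S f k| <= \sum_(k < r) a.-1.
    by apply: leq_sum => k _; have := none k; lia.
  rewrite sumS sum_nat_const card_ord; nia.
apply: leq_trans (_ : (\prod_k B (N - #|S f k|)) * B N ^ 2 <= _).
  by rewrite leq_mul2r; apply/orP; right; apply: leq_prod => k _; exact: card_min_rows.
rewrite (bigD1 k0) //= -big_filter.
move: sumS; rewrite (bigD1 k0) //= -big_filter => sumS.
have sz : size [seq k <- index_enum 'I_r | k != k0] = r.-1.
  have -> : r.-1 = #|predC1 k0| by rewrite cardC1 card_ord.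
  by rewrite -sum1_size big_filter -sum1_card; apply: eq_bigl => k; rewrite !inE.
(* The fibres other than that of [k0] have total size [N - #|S f k0|], so merging their factors
   leaves [B #|S f k0|], to be balanced against [B (N - #|S f k0|)]. *)
have := log_convex_prod B_gt0 B_log_convex
  (l := [seq k <- index_enum 'I_r | k != k0]) (s := fun k => #|S f k|) (N := N).
rewrite sz -[X in B (X - _)]sumS addnK.
move=> /(_ (leq_trans (leq_addl _ _) (eq_leq sumS))).
have s0N : #|S f k0| <= N := leq_trans (leq_addr _ _) (eq_leq sumS).
have aN : a <= N - #|S f k0| by have := small k0; lia.
have := log_convex_balance B_gt0 B_log_convex large aN s0N.
have -> : B N ^ r = B N * B N ^ r.-1 by rewrite -expnS prednK.
rewrite expnS expn1; set x := \prod_(_ <- _) _; set s := #|S f k0|.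
move=> h1 h2; have := leq_mul h1 (leqnn (B N * B N ^ r.-1)).
have : x * B N * (B (N - s) * B N) <= B s * B N ^ r.-1 * (B (N - s) * B N).
  by rewrite leq_mul.
by move: (B N ^ _) => y; lia.
Qed.

Lemma card_bad_tuple r : 0 < r -> exists K N0, forall N, N0 <= N ->
  #|[pred t : {ffun 'I_r -> monotone_triangle N.+1} | bad_tuple t]| * B N * N
  <= K * B N ^ r.
Proof.
move=> r_gt0; set a := 8 * r.+1.
(* The power [a + 2] obtained here pays for the choice of [a] non-minimal rows, for the row [i], and
   for the factor [N] gained in the statement. *)
have [K1 h1] := ratio_superpoly B_gt0 B_log_convex B0 B_lower a.+1.
have [K2 h2] := ratio_superexp B_gt0 B_log_convex B0 B_lower r.
exists (r * r * B a * K1 + B a * K2), (r * a).+1 => -[//|N] leN.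
have aN : a <= N.+1 by rewrite /a in leN *; nia.
rewrite -(leq_pmul2r (B_gt0 N.+1)).
have split_bad : #|[pred t : {ffun 'I_r -> monotone_triangle N.+2} | bad_tuple t]| <=
    #|[pred t : {ffun 'I_r -> monotone_triangle N.+2} |
      bad_tuple t && [exists k, #|~: min_rows (t k)| <= a]]| +
    #|[pred t : {ffun 'I_r -> monotone_triangle N.+2} |
      bad_tuple t && [forall k, a < #|~: min_rows (t k)|]]|.
  rewrite -cardUI; apply: leq_trans (leq_addr _ _); apply: subset_leq_card.
  apply/fintype.subsetP => t; rewrite !inE => -> /=.
  apply/orP; case: (boolP [exists k, _]) => [|none]; [by left | right].
  by move: none; rewrite negb_exists => /forallP h; apply/forallP => k; rewrite ltnNge.
have few := card_bad_tuple_few r N a.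
have many : _ := card_bad_tuple_many r_gt0 (_ : 0 < a) (ltnW leN).
have {}many := many isT.
move: split_bad few many.
set x := #|_|; set y := #|_|; set z := #|_| => xyz.
have {h1} := h1 N; have {h2} := h2 N.+1 aN.
rewrite -/a 2![N.+1 ^ _.+1]expnS ![_ ^ 2]expnS expn1.
move: x y z xyz (B N.+1) (B N) (B a) (B (_ - _)) (B N.+1 ^ _) (N.+1 ^ _) (r ^ _)
  => x y z xyz b c g d p e q h2 h1 few many.
have hx := leq_mul xyz (leqnn (b * b * N.+1)).
have hy := leq_mul few (leqnn N.+1); have hz := leq_mul many (leqnn N.+1).
have h1' := leq_mul h1 (leqnn (r * r * g * p)); have h2' := leq_mul h2 (leqnn (g * p)).
lia.
Qed.

End Counting.

(** * Tuples with minimal infimum in terms of minimal rows *)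

Definition inf_min r n (t : {ffun 'I_r -> monotone_triangle n}) : bool :=
  inf_array t == tau_min n.

Lemma ord_bigmin_eq r n (F : 'I_r -> 'I_n.+1) : 0 < r ->
  exists k, \big[Order.min/ord_max]_(l < r) F l = F k.
Proof.
move=> r_gt0; have F_le k : xpredT k -> (F k <= ord_max)%O by rewrite leEord leq_ord.
by have [k _ ->] := eq_bigmin (Ordinal r_gt0) xpredT F isT F_le; exists k.
Qed.

Lemma inf_min_tau_min r n (t : {ffun 'I_r -> monotone_triangle n}) k :
  t k = tau_min n -> inf_min t.
Proof.
move=> tk; apply/eqP/ffunP => p; rewrite ffunE; apply/eqP; rewrite eq_le.
apply/andP; split.
  by rewrite -[X in (_ <= X)%O](congr1 (fun u : monotone_triangle n => u p) tk) bigmin_le.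
have [l ->] := ord_bigmin_eq (fun l => t l p) (leq_ltn_trans (leq0n k) (ltn_ord k)).
rewrite leEord tau_min_arrayE -entry_tag; apply: triangle_ge; first exact: entry_spec.
  exact: ltn_ord.
by rewrite -ltnS; exact: ltn_ord.
Qed.

Lemma inf_min_row r N (t : {ffun 'I_r -> monotone_triangle N.+1}) (i : 'I_N) : 0 < r ->
  inf_min t -> exists k, row_min (t k) i.
Proof.
move=> r_gt0 /eqP e; have li : i < N.+1 by apply: leqW.
have := congr1 (fun u : array N.+1 => nat_of_ord (u (cell li (ltnSn i)))) e.
rewrite /= tau_min_arrayE ffunE.
have [k ->] := ord_bigmin_eq (fun k => t k (cell li (ltnSn i))) r_gt0.
by move=> tk; exists k; rewrite /row_min (entry_cell _ li (ltnSn i)) tk.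
Qed.

(** Tuples with minimal infimum and tuples avoiding [tau_min] together exhaust all tuples, and [b]
    counts their overlap. The term [(B N).-1 ^ r] stands on the left to avoid subtraction. *)
Lemma card_inf_min r N : 0 < r ->
  exists2 b, #|[pred t : {ffun 'I_r -> monotone_triangle N.+1} | inf_min t]| + (B N).-1 ^ r
    = B N ^ r + b &
  b <= #|[pred t : {ffun 'I_r -> monotone_triangle N.+1} | bad_tuple t]|.
Proof.
move=> r_gt0.
exists #|[pred t : {ffun 'I_r -> monotone_triangle N.+1} |
  inf_min t && [forall k, t k != tau_min N.+1]]|; last first.
  apply: subset_leq_card; apply/fintype.subsetP => t; rewrite !inE => /andP[it nt].
  rewrite /bad_tuple nt andbT; apply/forallP => i; apply/existsP; exact: inf_min_row.
have eN : B N ^ r = #|{: {ffun 'I_r -> monotone_triangle N.+1}}|.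
  by rewrite card_ffun card_ord.
have eP : (B N).-1 ^ r = #|[pred t : {ffun 'I_r -> monotone_triangle N.+1} |
    [forall k, t k != tau_min N.+1]]|.
  rewrite (card_ffun_forall (fun=> predC1 (tau_min N.+1))) prod_nat_const card_ord.
  by congr (_ ^ _); rewrite cardC1.
rewrite eN eP -cardUI; congr (_ + _).
apply: eq_card => t; rewrite !inE /=.
case: (boolP [forall k, _]) => [|]; rewrite ?orbT // negb_forall orbF.
by move=> /existsP[k]; rewrite negbK => /eqP; exact: inf_min_tau_min.
Qed.

(** * Probability *)

Local Open Scope classical_set_scope.
Local Open Scope ring_scope.

(** The event is a finite disjoint union of the fibres [V s], and independence over the full index
    set gives each the same probability. *)
Lemma prob_uniform_tuple (d : measure_display) (T : measurableType d) (R : realType)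
    (P : probability T R) (I S : finType) (X : I -> T -> S) (E : pred {ffun I -> S}) :
  (forall k, random_element (X k)) -> (forall k, uniform_law P (X k)) ->
  mutually_independent P X ->
  P [set w | E [ffun k => X k w]] =
    (#|[pred s | E s]|%:R / #|S|%:R ^+ #|I|)%:E.
Proof.
move=> Xm Xu Xi; pose V (s : {ffun I -> S}) := [set w | [ffun k => X k w] = s].
have VE s : V s = \bigcap_(k in [set` [set: I]%SET]) X k @^-1` [set s k].
  apply/seteqP; split=> w /=; first by move=> <- k _ /=; rewrite ffunE.
  by move=> h; apply/ffunP => k; rewrite ffunE; apply: h; rewrite /= inE.
have mV s : measurable (V s).
  rewrite VE; apply: fin_bigcap_measurable; first exact: finite_finset.
  by move=> k _; exact: Xm.
have PV s : P (V s) = (#|S|%:R ^- #|I|)%:E.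
  rewrite VE Xi (eq_bigr (fun=> (#|S|%:R^-1)%:E)); last by move=> k _; exact: Xu.
  rewrite prodEFin prodr_const cardsT -exprVn //.
have -> : [set w | E [ffun k => X k w]] = \bigcup_(s in [set` E]) V s.
  apply/seteqP; split=> w /=; first by move=> Ew; exists [ffun k => X k w].
  by move=> [s Es]; rewrite /V /= => ->.
have tV : trivIset [set` E] V.
  by move=> s u _ _ [w []]; rewrite /V /= => -> ->.
rewrite (measure_fin_bigcup _ (finite_finpred _) tV) //.
rewrite -(bigfs _ (r := index_enum _)) ?index_enum_uniq //; last first.
  by move=> i _; rewrite mem_index_enum.
rewrite (eq_bigr (fun=> (#|S|%:R ^- #|I|)%:E)); last by move=> s _; exact: PV.
by rewrite sumEFin sumr_const mulr_natl; congr (_ *+ _)%:E; exact: eq_card.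
Qed.

Lemma bernoulli_bounds (R : realFieldType) (x : R) r : 0 <= x <= 1 ->
  1 - r%:R * x <= (1 - x) ^+ r <= 1 - r%:R * x + r%:R ^+ 2 * x ^+ 2.
Proof.
move=> /andP[x0 x1]; elim: r => [|r /andP[IH1 IH2]].
  by rewrite expr0 mul0r expr0n mul0r subr0 addr0 lexx.
have r0 : 0 <= r%:R :> R by [].
rewrite exprS -natr1; have y0 : 0 <= 1 - x by lra.
have := ler_wpM2l y0 IH1; have := ler_wpM2l y0 IH2.
set y := (1 - x) ^+ r; set c := r%:R : R => h2 h1.
apply/andP; split; nra.
Qed.

(** With [x = 1 / B N] the probability is [1 - (1 - x) ^ r] plus the share of bad tuples. The
    second-order term is at most [r ^ 2 * x ^ 2] with [x <= K' / N], and the bad share is at most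
    [K / N * x]; this explains the constant. *)
Lemma inf_min_estimate (R : realType) r : (0 < r)%N ->
  exists C : R, \forall N \near \oo,
    `|#|[pred t : {ffun 'I_r -> monotone_triangle N.+1} | inf_min t]|%:R
        / (B N)%:R ^+ r - r%:R / (B N)%:R| <= C / N%:R / (B N)%:R.
Proof.
move=> r_gt0; have [K [N0 hK]] := card_bad_tuple r_gt0.
have [K' hK'] := ratio_superpoly B_gt0 B_log_convex B0 B_lower 0.
exists (r%:R ^+ 2 * K'%:R + K%:R); exists (maxn N0 1) => // N /=.
rewrite geq_max => /andP[N0N N1].
have [b e hb] := card_inf_min N r_gt0.
set c := #|_| in e *; set a : R := (B N)%:R; set x := a^-1.
have a1 : 1 <= a by rewrite ler1n B_gt0.
have a0 : 0 < a by lra.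
have ar0 : 0 < a ^+ r by rewrite exprn_gt0.
have x0 : 0 < x by rewrite invr_gt0.
have x1 : x <= 1 by rewrite invf_le1.
have n0 : 0 < N%:R :> R by rewrite ltr0n.
have cE : c%:R / a ^+ r = 1 + b%:R / a ^+ r - (1 - x) ^+ r.
  have : c%:R + (a - 1) ^+ r = a ^+ r + b%:R.
    rewrite /a -natrX -natrD -e natrD natrX -subn1 natrB //; exact: B_gt0.
  have -> : (1 - x) ^+ r = (a - 1) ^+ r / a ^+ r.
    by rewrite -expr_div_n mulrBl mulfV ?mul1r // gt_eqF.
  move=> /(canRL (addrK _)) ->; rewrite mulrBl mulrDl mulfV ?gt_eqF //.
have b_ge0 : 0 <= b%:R / a ^+ r by rewrite divr_ge0 // ltW.
have b_le : b%:R / a ^+ r <= K%:R / N%:R * x.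
  rewrite ler_pdivrMr // mulrAC -/x ler_pdivlMr // mulrAC ler_pdivlMr //.
  rewrite /a -natrX -!natrM ler_nat.
  by apply: leq_trans (hK N N0N); rewrite -!mulnA leq_mul // mulnC.
have x_le : x <= K'%:R / N%:R.
  rewrite ler_pdivlMr // mulrC ler_pdivrMr // /a -natrM ler_nat.
  case: (N) N1 => // M _; apply: leq_trans (hK' M).
  by rewrite expn1 leq_pmulr // B_gt0.
have /andP[l1 l2] : 1 - r%:R * x <= (1 - x) ^+ r <= 1 - r%:R * x + r%:R ^+ 2 * x ^+ 2.
  by apply: bernoulli_bounds; rewrite ltW.
have rx : r%:R ^+ 2 * x ^+ 2 <= r%:R ^+ 2 * (K'%:R / N%:R) * x.
  by rewrite [x ^+ 2]expr2 mulrA ler_wpM2r ?(ltW x0) // ler_wpM2l // exprn_ge0.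
have rx0 : 0 <= r%:R ^+ 2 * (K'%:R / N%:R) * x.
  by apply: le_trans rx; rewrite mulr_ge0 // exprn_ge0 // ltW.
rewrite cE -/x; set y := (1 - x) ^+ r in l1 l2 *.
have -> : (r%:R ^+ 2 * K'%:R + K%:R) / N%:R * x =
    r%:R ^+ 2 * (K'%:R / N%:R) * x + K%:R / N%:R * x by rewrite mulrDl mulrDl mulrA.
rewrite ler_norml; apply/andP; split; lra.
Qed.

Theorem theorem1 (R : realType) (r : nat) (r_ge1 : (1 <= r)%N)
    (d : nat -> measure_display)
    (T : forall n : nat, measurableType (d n))
    (P : forall n : nat, probability (T n) R)
    (tau : forall n : nat, 'I_r -> T n -> monotone_triangle n)
    (tau_rand : forall (n : nat) (k : 'I_r), random_element (tau n k))
    (tau_unif : forall (n : nat) (k : 'I_r), uniform_law (P n) (tau n k))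
    (tau_indep : forall n : nat, mutually_independent (P n) (tau n)) :
  (fun n : nat =>
     fine (P n [set w | inf_array (fun k => tau n k w) = tau_min n]) : R^o)
  ~_\oo (fun n : nat => r%:R / (A n)%:R : R^o).
Proof.
have [C [M _ hC]] := inf_min_estimate R r_ge1.
apply/eqaddoP => eps eps_gt0.
(* Beyond this index [N] exceeds [|C| / eps]; the outer successor accounts for [n = N.+1]. *)
exists (maxn M (Num.truncn (`|C| / eps)).+1).+1 => // -[//|N] /=.
rewrite ltnS geq_max => /andP[MN ltN].
have prE : P N.+1 [set w | inf_array (fun k => tau N.+1 k w) = tau_min N.+1] =
    (#|[pred t : {ffun 'I_r -> monotone_triangle N.+1} | inf_min t]|%:R
      / (B N)%:R ^+ r)%:E.
  have := prob_uniform_tuple (@inf_min r N.+1) (tau_rand _) (tau_unif _) (tau_indep N.+1).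
  rewrite card_ord -/(A N.+1) -/(B N) => <-.
  congr (P _ _); apply/seteqP; split=> w /=; rewrite /inf_min;
    (have -> : inf_array [ffun k => tau N.+1 k w] = inf_array (tau N.+1 ^~ w)
      by apply/ffunP => p; rewrite !ffunE; apply: eq_bigr => k _; rewrite ffunE).
    by move=> ->.
  by move/eqP.
rewrite -[X in `|X|]/(fine (P N.+1
    [set w | inf_array (fun k => tau N.+1 k w) = tau_min N.+1])
   - r%:R / (B N)%:R) prE /=.
have N_gt0 : 0 < N%:R :> R by rewrite ltr0n; apply: leq_trans ltN.
have B_gt : 0 < (B N)%:R :> R by rewrite ltr0n B_gt0.
apply: le_trans (hC N MN) _; rewrite normrM normfV !normr_nat mulrA.
rewrite ler_wpM2r ?invr_ge0 ?(ltW B_gt) //.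
rewrite ler_pdivrMr //; apply: le_trans (ler_norm C) _.
have : `|C| / eps < N%:R.
  by apply: lt_le_trans (truncnS_gt _) _; rewrite ler_nat.
rewrite ltr_pdivrMr // => lt_C; apply: le_trans (ltW lt_C) _.
rewrite mulrC -mulrA ler_wpM2l ?(ltW eps_gt0) // ler_peMl ?ler1n // ltW.
Qed.
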